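(* Let $n\ge 1$ and let $(G,H,P_G,B_H)$ be as in Case (A) or Case (B) described in the context. Then the map $\omega_{\tau_1,\tau_2}\mapsto B_H\,[\omega_{\tau_1,\tau_2}]$ induces a bijection $$\mathbb{Z}_2^n\backslash \Omega^{\circ}_n/(\mathbb{Z}_2^n\rtimes\mathfrak{S}_n)\;\xrightarrow{\ \sim\ }\; B_H\backslash G/P_G\;\simeq\; H\backslash \mathfrak{X}.$$ In particular, in both Cases (A) and (B) the orbit spaces $H\backslash\mathfrak{X}$ have the same set of representatives.
   Context: Case (A): $J_n=\sqrt{-1}\begin{pmatrix}0&\mathbf 1_n\\-\mathbf 1_n&0\end{pmatrix}$, $G=\mathrm{U}(n,n)=\{g\in\mathrm{GL}_{2n}(\mathbb C): g^*J_ng=J_n\}$ (where $g^*=\overline{g}^{\,t}$), $P_G=\left\{\begin{pmatrix}a&u\\0&(a^* )^{-1}\end{pmatrix}: a\in\mathrm{GL}_n(\mathbb C),\ a^{-1}u \text{ Hermitian}\right\}$ (the stabilizer of $\mathbb C^n\oplus 0$), $H=\{\mathrm{diag}(a,(a^* )^{-1}):a\in\mathrm{GL}_n(\mathbb C)\}\cong\mathrm{GL}_n(\mathbb C)$, $B_H=\{\mathrm{diag}(b,(b^* )^{-1}): b\in\mathrm{GL}_n(\mathbb C)\text{ upper triangular}\}$. Then $G/P_G$ is identified with the set of $n$-dimensional subspaces $W\subset\mathbb C^{2n}$ with $u^*J_nv=0$ for all $u,v\in W$ (Hermitian Lagrangian subspaces), a closed subset of $\mathrm{Gr}_n(\mathbb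 C^{2n})$. Case (B): $\Sigma_n=\begin{pmatrix}0&\mathbf 1_n\\-\mathbf 1_n&0\end{pmatrix}$, $G=\mathrm{Sp}_{2n}(\mathbb R)=\{g\in\mathrm{GL}_{2n}(\mathbb R): g^t\Sigma_ng=\Sigma_n\}$, $P_G=\left\{\begin{pmatrix}a&u\\0&(a^{t})^{-1}\end{pmatrix}: a\in\mathrm{GL}_n(\mathbb R),\ a^{-1}u\text{ symmetric}\right\}$, $H=\{\mathrm{diag}(a,(a^t)^{-1}):a\in\mathrm{GL}_n(\mathbb R)\}$, $B_H$ the same with $a$ real upper triangular invertible. $G/P_G$ is identified with the Lagrangian Grassmannian of $(\mathbb R^{2n},\Sigma_n)$ inside $\mathrm{Gr}_n(\mathbb R^{2n})$. In both cases $\mathfrak X=H/B_H\times G/P_G$ with diagonal $H$-action (the double flag variety), and $H\backslash\mathfrak X\simeq B_H\backslash G/P_G$ naturally. For a $2n\times n$ matrix $\omega$ of rank $n$, $[\omega]$ denotes its column space (image of $\omega$ as a linear map), an $n$-dimensional subspace. A signed partial permutation is an $n\times n$ integer matrix with entries in $\{-1,0,1\}$ having at most one nonzero entry in each row and each column; $\mathrm{SPP}_n$ is their set. $\Omega^{\circ}_n$ is the set of $\omega_{\tau_1,\tau_2}=\begin{pmatrix}\tau_1\\\tau_2\end{pmatrix}\in\mathrm M_{2n,n}(\mathbb Z)$ with $\tau_1,\tau_2\in\mathrm{SPP}_n$, $\tau_1^t\tau_2$ symmetric, and $\mathrm{rank}\,\omega_{\tau_1,\tau_2}=n$ (so $[\omega_{\tau_1,\tau_2}]$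 is a point of $G/P_G$ in both cases). The group $\mathbb Z_2^n=\{\pm1\}^n$ acts on $\Omega^\circ_n$ from the left by multiplication by $\mathrm{diag}(\varepsilon_1,\dots,\varepsilon_n,\varepsilon_1,\dots,\varepsilon_n)$, and $\mathbb Z_2^n\rtimes\mathfrak S_n$ (the group of $n\times n$ signed permutation matrices, generated by $\mathrm{diag}(\varepsilon_1,\dots,\varepsilon_n)$ and permutation matrices) acts by right multiplication. *)

(* Defs.v *)
From HB Require Import structures.
From mathcomp Require Import all_boot all_order all_algebra all_fingroup.
From mathcomp Require Import reals complex.
Set Implicit Arguments. Unset Strict Implicit. Unset Printing Implicit Defensive.
Import Order.TTheory GRing.Theory Num.Theory.
Local Open Scope ring_scope.

Definition is_spp (n : nat) (t : 'M[int]_n) : bool :=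
  [&& [forall i, forall j, t i j \in [:: -1; 0; 1]],
      [forall i, forall j, forall j',
         ((t i j != 0) && (t i j' != 0)) ==> (j == j')] &
      [forall j, forall i, forall i',
         ((t i j != 0) && (t i' j != 0)) ==> (i == i')]].

Definition omega (n : nat) (t1 t2 : 'M[int]_n) : 'M[int]_(n + n, n) :=
  col_mx t1 t2.

(* the set Omega°_n; rank is the rank over Q (= rank over any field of
   characteristic 0) *)
Definition in_Omega0 (n : nat) (w : 'M[int]_(n + n, n)) : Prop :=
  exists t1 t2 : 'M[int]_n,
    [/\ w = omega t1 t2, is_spp t1, is_spp t2,
        (t1^T *m t2)^T = t1^T *m t2 &
        \rank (map_mx (intr : int -> rat) w) = n].

Definition sign_diag (n : nat) (e : {ffun 'I_n -> bool}) : 'M[int]_n :=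
  diag_mx (\row_i ((-1) ^+ e i)).

Definition is_signed_perm (n : nat) (s : 'M[int]_n) : Prop :=
  exists (e : {ffun 'I_n -> bool}) (p : 'S_n), s = sign_diag e *m perm_mx p.

Definition Omega_equiv (n : nat) (w w' : 'M[int]_(n + n, n)) : Prop :=
  exists (e : {ffun 'I_n -> bool}) (s : 'M[int]_n),
    is_signed_perm s /\
    w' = block_mx (sign_diag e) 0 0 (sign_diag e) *m w *m s.

Definition Sigma_mx (F : fieldType) (n : nat) : 'M[F]_(n + n) :=
  block_mx 0 1%:M (- 1%:M) 0.

Definition adj_mx (F : fieldType) (conj : F -> F) (m k : nat)
  (A : 'M[F]_(m, k)) : 'M[F]_(k, m) := (map_mx conj A)^T.

(* the column space of M (2n x n, rank n) is a Lagrangian subspace,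
   i.e. a point of G/P_G, for the form u^* J v *)
Definition lagrangian (F : fieldType) (conj : F -> F) (n : nat)
  (J : 'M[F]_(n + n)) (M : 'M[F]_(n + n, n)) : Prop :=
  \rank M = n /\ adj_mx conj M *m J *m M = 0.

Definition upper_tri (F : fieldType) (n : nat) (b : 'M[F]_n) : bool :=
  [forall i : 'I_n, forall j : 'I_n, (j < i)%N ==> (b i j == 0)].

Definition H_elt (F : fieldType) (conj : F -> F) (n : nat) (b : 'M[F]_n)
  : 'M[F]_(n + n) := block_mx b 0 0 (invmx (adj_mx conj b)).

(* column spaces: [M] = [M'] iff the row spaces of the transposes agree *)
Definition same_colspace (F : fieldType) (m k : nat) (M M' : 'M[F]_(m, k))
  : bool := (M^T == M'^T)%MS.

Definition BH_equiv (F : fieldType) (conj : F -> F) (n : nat)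
  (M M' : 'M[F]_(n + n, n)) : Prop :=
  exists b : 'M[F]_n,
    [/\ upper_tri b, b \in unitmx & same_colspace (H_elt conj b *m M) M'].

Definition intmx (F : fieldType) (m k : nat) (w : 'M[int]_(m, k))
  : 'M[F]_(m, k) := map_mx (intr : int -> F) w.

(* w |-> B_H [w] induces a bijection
   Z_2^n \ Omega°_n / (Z_2^n ⋊ S_n)  ->  B_H \ G / P_G
   (G/P_G identified with the Lagrangian subspaces for J). *)
Definition induces_bijection (F : fieldType) (conj : F -> F) (n : nat)
  (J : 'M[F]_(n + n)) : Prop :=
  [/\
      (forall w : 'M[int]_(n + n, n), in_Omega0 w -> lagrangian conj J (intmx F w)),
      (forall w w' : 'M[int]_(n + n, n), in_Omega0 w -> in_Omega0 w' -> Omega_equiv w w' ->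
          BH_equiv conj (intmx F w) (intmx F w')),
      (forall w w' : 'M[int]_(n + n, n), in_Omega0 w -> in_Omega0 w' ->
          BH_equiv conj (intmx F w) (intmx F w') -> Omega_equiv w w') &
      (forall M, lagrangian conj J M ->
          exists w, in_Omega0 w /\ BH_equiv conj (intmx F w) M)].

Definition caseA (R : realType) (n : nat) : Prop :=
  @induces_bijection R[i] (@conjc R) n ((Complex 0 1) *: Sigma_mx R[i] n).

Definition caseB (R : realType) (n : nat) : Prop :=
  @induces_bijection R id n (Sigma_mx R n).

(* Main.v *)
Require Import Defs.
From HB Require Import structures.
From mathcomp Require Import all_boot all_order all_algebra all_fingroup.
From mathcomp Require Import reals complex.
Set Implicit Arguments. Unset Strict Implicit. Unset Printing Implicit Defensive.
Import Order.TTheory GRing.Theory Num.Theory.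
Local Open Scope ring_scope.

(* Every class on both sides contains a normal form [D_T + X ; D_(~: T)], where
   D_T is the coordinate projection onto T and X is a symmetric signed partial
   permutation supported off T.

   For Omega°, a row i vanishing in the bottom block makes e_i orthogonal to
   the subspace, hence a member of it, and this yields the pivot column needed
   to move the top block into normal form by a signed permutation.

   For a Lagrangian subspace, the lower triangular group acting on the bottom
   block kills the rows depending on the preceding ones (these are the rows in
   T); what remains is the graph of a Hermitian form, which upper triangular
   congruence reduces to a signed partial involution by splitting off lines and
   hyperbolic planes.

   Conversely, if b carries one normal form to another, then T agrees and
   b X = X' c off T, with b upper and c = (b^* )^-1 lower triangular. Comparing
   pivots gives the same support for X and X', and b_ii conj(b_ii) > 0 gives
   the same diagonal signs; the off-diagonal signs are removed by the left
   action of sign changes. *)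

(** * Inverses of upper triangular matrices *)

Lemma invmx_mul (R : comUnitRingType) n (b c : 'M[R]_n) :
  b \in unitmx -> c \in unitmx -> invmx (b *m c) = invmx c *m invmx b.
Proof.
move=> ub uc; have ubc : b *m c \in unitmx by rewrite unitmx_mul ub.
by rewrite -[RHS](mulKmx ubc) -mulmxA mulKVmx // mulmxV // mulmx1.
Qed.

Section UpperTriangular.
Context (F : fieldType) (n : nat).
Implicit Types b c : 'M[F]_n.

Lemma upper_triP b :
  reflect (forall i j : 'I_n, (j < i)%N -> b i j = 0) (upper_tri b).
Proof.
apply: (iffP forallP) => [h i j ji | h i].
  by have /forallP/(_ j)/implyP/(_ ji)/eqP := h i.
by apply/forallP=> j; apply/implyP=> ji; apply/eqP/h.
Qed.

Lemma upper_tri_trig b : upper_tri b -> is_trig_mx b^T.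
Proof. by move=> /upper_triP h; apply/is_trig_mxP=> i j ij; rewrite mxE h. Qed.

Lemma upper_triM b c : upper_tri b -> upper_tri c -> upper_tri (b *m c).
Proof.
move=> /upper_triP hb /upper_triP hc; apply/upper_triP=> i j ji.
rewrite mxE big1 // => k _; have [ki|ik] := ltnP k i; first by rewrite hb ?mul0r.
by rewrite hc ?mulr0 // (leq_trans ji).
Qed.

Lemma upper_tri_unitP b :
  upper_tri b -> reflect (forall i, b i i != 0) (b \in unitmx).
Proof.
move=> hb; rewrite -unitmx_tr unitmxE det_trig ?upper_tri_trig // unitfE.
apply: (iffP idP) => [/prodf_neq0 h i | h].
  by have := h i isT; rewrite mxE.
by apply/prodf_neq0=> i _; rewrite mxE.
Qed.

(** Induction on [n - i], from the last row upwards. For [j < i], the [(i, j)] entry of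
    [b *m invmx b = 1] loses its terms with [k < i] because [b] is upper triangular and those with
    [k > i] by induction. What remains is [b i i * invmx b i j = 0]. *)
Lemma upper_tri_invmx b : upper_tri b -> b \in unitmx -> upper_tri (invmx b).
Proof.
move=> hb ub; apply/upper_triP=> i j; have [m] := ubnP (n - i).
elim: m i => // m IH i hm ji.
have /matrixP/(_ i j) := mulmxV ub; rewrite !mxE (bigD1 i) //= big1 => [|k ki].
  rewrite addr0 -val_eqE /= gtn_eqF // => /eqP; rewrite mulf_eq0.
  by rewrite (negbTE (upper_tri_unitP hb ub i)) => /eqP.
have [lt_ki|ik] := ltnP k i; first by rewrite (upper_triP _ hb) ?mul0r.
have {ki ik} ik : (i < k)%N by rewrite ltn_neqAle eq_sym ki.
rewrite IH ?mulr0 //; last exact: ltn_trans ik.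
exact: leq_trans (ltn_sub2l (ltn_ord i) ik) hm.
Qed.

Lemma invmx_diag_upper_tri b i :
  upper_tri b -> b \in unitmx -> invmx b i i = (b i i)^-1.
Proof.
move=> hb ub; have bi0 := upper_tri_unitP hb ub i.
apply: (mulfI bi0); rewrite divff //.
have /matrixP/(_ i i) := mulmxV ub; rewrite !mxE eqxx (bigD1 i) //= big1 => [|k ki].
  by rewrite addr0.
have [lt_ki|ik] := ltnP k i; first by rewrite (upper_triP _ hb) ?mul0r.
rewrite (upper_triP _ (upper_tri_invmx hb ub)) ?mulr0 //.
by rewrite ltn_neqAle eq_sym ki.
Qed.

End UpperTriangular.

(** * Adjoints, Lagrangian subspaces and the action of [B_H] *)

Section Forms.
Context (F : fieldType) (conj : {rmorphism F -> F}).
Hypothesis conjK : involutive conj.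
Local Notation adj := (adj_mx conj).

Lemma adj_mxM m n p (A : 'M[F]_(m, n)) (B : 'M_(n, p)) :
  adj (A *m B) = adj B *m adj A.
Proof. by rewrite /adj_mx map_mxM trmx_mul. Qed.

Lemma adj_mxK m n (A : 'M[F]_(m, n)) : adj (adj A) = A.
Proof. by apply/matrixP=> i j; rewrite !mxE conjK. Qed.

Lemma adj_mxD m n (A B : 'M[F]_(m, n)) : adj (A + B) = adj A + adj B.
Proof. by rewrite /adj_mx map_mxD linearD. Qed.

Lemma adj_mx1 n : adj (1%:M : 'M[F]_n) = 1%:M.
Proof. by rewrite /adj_mx map_mx1 trmx1. Qed.

Lemma adj_mx_unit n (b : 'M[F]_n) : (adj b \in unitmx) = (b \in unitmx).
Proof. by rewrite unitmx_tr map_unitmx. Qed.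

Lemma adj_mx_inv n (b : 'M[F]_n) : adj (invmx b) = invmx (adj b).
Proof. by rewrite /adj_mx map_invmx trmx_inv. Qed.

Lemma adj_col_mx m1 m2 n (A : 'M[F]_(m1, n)) (B : 'M_(m2, n)) :
  adj (col_mx A B) = row_mx (adj A) (adj B).
Proof. by rewrite /adj_mx map_col_mx tr_col_mx. Qed.

Lemma mxrank_adj m n (A : 'M[F]_(m, n)) : \rank (adj A) = \rank A.
Proof. by rewrite /adj_mx mxrank_tr mxrank_map. Qed.

Lemma Sigma_col n p q (A C : 'M[F]_(n, p)) (A' C' : 'M_(n, q)) :
  adj (col_mx A C) *m Sigma_mx F n *m col_mx A' C' = adj A *m C' - adj C *m A'.
Proof.
rewrite adj_col_mx -mulmxA mul_block_col !mul0mx mulNmx !mul1mx add0r addr0.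
by rewrite mul_row_col mulmxN.
Qed.

Lemma same_colspace_mulr m k (M : 'M[F]_(m, k)) (g : 'M_k) :
  g \in unitmx -> same_colspace (M *m g) M.
Proof.
move=> ug; rewrite /same_colspace trmx_mul submxMl /=.
by rewrite -{1}(mulKmx (x := g^T) _ M^T) ?submxMl // unitmx_tr.
Qed.

Lemma same_colspace_mull m p k (A : 'M[F]_(p, m)) (M M' : 'M_(m, k)) :
  same_colspace M M' -> same_colspace (A *m M) (A *m M').
Proof. by rewrite /same_colspace !trmx_mul => /andP[h1 h2]; rewrite !submxMr. Qed.

Lemma same_colspace_sym m k (M M' : 'M[F]_(m, k)) :
  same_colspace M M' -> same_colspace M' M.
Proof. by rewrite /same_colspace andbC. Qed.

Lemma same_colspace_trans m k (M M' M'' : 'M[F]_(m, k)) :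
  same_colspace M M' -> same_colspace M' M'' -> same_colspace M M''.
Proof.
move=> /andP[h1 h2] /andP[h3 h4].
by rewrite /same_colspace (submx_trans h1 h3) (submx_trans h4 h2).
Qed.

Lemma same_colspaceP m k (M M' : 'M[F]_(m, k)) :
  same_colspace M M' -> exists g : 'M_k, M = M' *m g.
Proof.
move=> /andP[/submxP[D eD] _]; exists D^T.
by apply: trmx_inj; rewrite trmx_mul trmxK.
Qed.

Section Lagrangian.
Context (n : nat).
Local Notation Sig := (Sigma_mx F n).

Lemma Sigma_sqr : Sig *m Sig = - 1%:M.
Proof.
rewrite mulmx_block !(mul0mx, mulmx0, mulmxN, mulNmx, mul1mx, add0r, addr0, oppr0).
by rewrite scalar_mx_block opp_block_mx !oppr0.
Qed.

Lemma Sigma_unit : Sig \in unitmx.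
Proof.
have : Sig *m (- Sig) = 1%:M by rewrite mulmxN Sigma_sqr opprK.
by case/mulmx1_unit.
Qed.

(* A Lagrangian subspace is its own orthogonal complement. *)
Lemma lagrangian_max k (M : 'M[F]_(n + n, n)) (V : 'M_(n + n, k)) :
  lagrangian conj Sig M -> adj M *m Sig *m V = 0 -> exists Z, V = M *m Z.
Proof.
move=> [rM MM] MV; set K := kermx (adj M *m Sig)^T.
have sK p (U : 'M_(n + n, p)) : adj M *m Sig *m U = 0 -> (U^T <= K)%MS.
  by move=> h; apply/sub_kermxP; rewrite -trmx_mul h trmx0.
(* The rows of [K] span the orthogonal complement. Nondegeneracy of [Sig] gives it dimension
   [2n - n], so it cannot exceed the subspace it contains. *)
have rK : \rank K = n.
  rewrite mxrank_ker mxrank_tr mxrankMfree ?mxrank_adj ?rM ?addnK //.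
  by rewrite row_free_unit Sigma_unit.
have eK : (M^T == K)%MS.
  by rewrite -(mxrank_leqif_eq (sK _ _ MM)) mxrank_tr rM rK.
have /submxP[D eD] : (V^T <= M^T)%MS by rewrite (submx_trans (sK _ _ MV)) //; case/andP: eK.
by exists D^T; apply: trmx_inj; rewrite trmx_mul trmxK.
Qed.

(** Orthogonality puts one subspace inside the other, and the dimensions agree. This allows column
    spaces to be compared without exhibiting a change of basis. *)
Lemma lagrangian_same_colspace (M N : 'M[F]_(n + n, n)) :
  lagrangian conj Sig M -> \rank N = n -> adj M *m Sig *m N = 0 ->
  same_colspace N M.
Proof.
move=> LM rN /(lagrangian_max LM)[Z eN].
have sNM : (N^T <= M^T)%MS by rewrite eN trmx_mul submxMl.
by rewrite /same_colspace -(mxrank_leqif_eq sNM) !mxrank_tr rN (proj1 LM).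
Qed.

(** Lets both cases be treated with the form [Sig]: the scalar is the imaginary unit in Case (A) and
    [1] in Case (B). *)
Lemma lagrangianZ (k : F) (M : 'M[F]_(n + n, n)) :
  k != 0 -> lagrangian conj (k *: Sig) M <-> lagrangian conj Sig M.
Proof.
move=> k0; rewrite /lagrangian -scalemxAr -scalemxAl.
split=> -[-> h]; split=> //; last by rewrite h scaler0.
by apply/eqP; move/eqP: h; rewrite scaler_eq0 (negbTE k0).
Qed.

Lemma lagrangian_col (A C : 'M[F]_n) :
  lagrangian conj Sig (col_mx A C) <->
  \rank (col_mx A C) = n /\ adj C *m A = adj A *m C.
Proof.
by rewrite /lagrangian Sigma_col; split=> -[-> h]; split=> //;
  [move/subr0_eq: h | rewrite h subrr].
Qed.

Lemma H_eltM (b c : 'M[F]_n) : b \in unitmx -> c \in unitmx ->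
  H_elt conj (b *m c) = H_elt conj b *m H_elt conj c.
Proof.
move=> ub uc; rewrite mulmx_block !mul0mx !mulmx0 !addr0 !add0r.
rewrite /H_elt adj_mxM invmx_mul ?adj_mx_unit //.
Qed.

Lemma H_elt1 : H_elt conj (1%:M : 'M[F]_n) = 1%:M.
Proof. by rewrite /H_elt adj_mx1 invmx1 -scalar_mx_block. Qed.

Lemma H_eltV (b : 'M[F]_n) : b \in unitmx ->
  H_elt conj (invmx b) *m H_elt conj b = 1%:M.
Proof. by move=> ub; rewrite -H_eltM ?unitmx_inv // mulVmx // H_elt1. Qed.

Lemma H_elt_col (b A C : 'M[F]_n) :
  H_elt conj b *m col_mx A C = col_mx (b *m A) (invmx (adj b) *m C).
Proof. by rewrite mul_block_col !mul0mx addr0 add0r. Qed.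

Lemma BH_equiv_sym (M M' : 'M[F]_(n + n, n)) :
  BH_equiv conj M M' -> BH_equiv conj M' M.
Proof.
case=> b [tb ub h]; exists (invmx b).
split; rewrite ?upper_tri_invmx ?unitmx_inv //.
have := same_colspace_mull (H_elt conj (invmx b)) (same_colspace_sym h).
by rewrite [X in same_colspace _ X]mulmxA H_eltV // mul1mx.
Qed.

Lemma BH_equiv_trans (M M' M'' : 'M[F]_(n + n, n)) :
  BH_equiv conj M M' -> BH_equiv conj M' M'' -> BH_equiv conj M M''.
Proof.
case=> b [tb ub h] [c [tc uc h']]; exists (c *m b).
split; rewrite ?upper_triM ?unitmx_mul ?ub ?uc //.
rewrite H_eltM // -mulmxA; apply: same_colspace_trans h'.
exact: same_colspace_mull.
Qed.

End Lagrangian.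
End Forms.

(** * Integer matrices viewed over a field of characteristic zero *)

Section IntegerMatrices.
Context (F : numFieldType) (conj : {rmorphism F -> F}).

Lemma adj_intmx m n (A : 'M[int]_(m, n)) :
  adj_mx conj (intmx F A) = intmx F A^T.
Proof. by apply/matrixP=> i j; rewrite !mxE rmorph_int. Qed.

Lemma intmxM m n p (A : 'M[int]_(m, n)) (B : 'M_(n, p)) :
  intmx F (A *m B) = intmx F A *m intmx F B.
Proof. exact: map_mxM. Qed.

(** The map from [int] to [F] factors through [rat], and a field embedding preserves rank. *)
Lemma mxrank_intmx m n (A : 'M[int]_(m, n)) :
  \rank (intmx F A) = \rank (intmx rat A).
Proof.
rewrite -(mxrank_map (ratr : {rmorphism rat -> F})) -map_mx_comp.
by congr mxrank; apply/matrixP=> i j; rewrite !mxE /= ratr_int.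
Qed.

Lemma intmx_lagrangian n (t1 t2 : 'M[int]_n) :
  (t1^T *m t2)^T = t1^T *m t2 -> \rank (intmx rat (omega t1 t2)) = n ->
  lagrangian conj (Sigma_mx F n) (intmx F (omega t1 t2)).
Proof.
move=> h rk; have := rk; rewrite -mxrank_intmx /intmx map_col_mx => rkF.
apply/lagrangian_col; split=> //.
by rewrite -!/(intmx F _) !adj_intmx -!intmxM -h trmx_mul trmxK.
Qed.

End IntegerMatrices.

(** * Signed permutations and the equivalence relation on integer matrices *)

Section SignedPermutations.
Context (n : nat).
Implicit Types (e : {ffun 'I_n -> bool}) (w : 'M[int]_(n + n, n)).

Lemma sign_diagM e e' :
  sign_diag e *m sign_diag e' = sign_diag [ffun i => e i (+) e' i].
Proof.
apply/matrixP=> i j; rewrite mul_diag_mx !mxE ffunE signr_addb.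
by case: eqVneq => [->|_]; rewrite ?mulr1n ?mulr0n ?mulr0.
Qed.

Lemma sign_diag_sqr e : sign_diag e *m sign_diag e = 1%:M.
Proof.
rewrite sign_diagM; apply/matrixP=> i j.
by rewrite !mxE ffunE addbb expr0.
Qed.

Lemma perm_mx_sign_diag (p : 'S_n) e :
  perm_mx p *m sign_diag e = sign_diag [ffun i => e (p i)] *m perm_mx p.
Proof.
apply/matrixP=> i j; rewrite mul_diag_mx mul_mx_diag !mxE !ffunE.
by case: eqVneq => [->|_]; rewrite ?mulr1 ?mul1r ?mulr0 ?mul0r.
Qed.

Lemma signed_perm_sign_diag e : is_signed_perm (sign_diag e).
Proof. by exists e, 1%g; rewrite perm_mx1 mulmx1. Qed.

Lemma signed_permM (s s' : 'M[int]_n) :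
  is_signed_perm s -> is_signed_perm s' -> is_signed_perm (s *m s').
Proof.
case=> e [p ->] [e' [p' ->]].
exists [ffun i => e i (+) [ffun i => e' (p i)] i], (p * p')%g.
by rewrite mulmxA -(mulmxA _ (perm_mx p)) perm_mx_sign_diag mulmxA -mulmxA
   -perm_mxM sign_diagM.
Qed.

Lemma signed_perm_inv (s : 'M[int]_n) : is_signed_perm s ->
  exists s', is_signed_perm s' /\ s *m s' = 1%:M.
Proof.
case=> e [p ->]; exists (perm_mx p^-1 *m sign_diag e); split.
  by rewrite perm_mx_sign_diag; exists [ffun i => e ((p^-1)%g i)], (p^-1)%g.
by rewrite -mulmxA (mulmxA (perm_mx p)) -perm_mxM mulgV perm_mx1 mul1mx
  sign_diag_sqr.
Qed.

Lemma block_sign_diagM e e' :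
  block_mx (sign_diag e) 0 0 (sign_diag e) *m
    block_mx (sign_diag e') 0 0 (sign_diag e') =
  block_mx (sign_diag e *m sign_diag e') 0 0 (sign_diag e *m sign_diag e').
Proof. by rewrite mulmx_block !mul0mx !mulmx0 !addr0 !add0r. Qed.

Lemma Omega_equiv_trans w w' w'' :
  Omega_equiv w w' -> Omega_equiv w' w'' -> Omega_equiv w w''.
Proof.
case=> e [s [hs ->]] [e' [s' [hs' ->]]].
exists [ffun i => e' i (+) e i], (s *m s'); split; first exact: signed_permM.
by rewrite -sign_diagM -block_sign_diagM !mulmxA.
Qed.

Lemma Omega_equiv_sym w w' : Omega_equiv w w' -> Omega_equiv w' w.
Proof.
case=> e [s [hs ->]]; have [s' [hs' ss']] := signed_perm_inv hs.
exists e, s'; split=> //; rewrite -!mulmxA ss' mulmx1 mulmxA block_sign_diagM.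
by rewrite sign_diag_sqr -scalar_mx_block mul1mx.
Qed.

End SignedPermutations.

(** * Coordinate projections and normal forms *)

Section NormalForms.
Context (n : nat).
Implicit Types (T : {set 'I_n}) (X : 'M[int]_n).

Definition coord_proj (R : nzRingType) T : 'M[R]_n :=
  diag_mx (\row_i (i \in T)%:R).

Definition normal_form (R : nzRingType) T (X : 'M[R]_n) : 'M[R]_(n + n, n) :=
  col_mx (coord_proj R T + X) (coord_proj R (~: T)).

(** Only rows are constrained; symmetry transfers the uniqueness of nonzero entries and the support
    condition to columns. *)
Definition normal_data T X : Prop :=
  [/\ X^T = X,
      forall i j, X i j \in [:: -1; 0; 1],
      forall i j k, X i j != 0 -> X i k != 0 -> j = k &
      forall i j, X i j != 0 -> i \notin T].

Section CoordProj.
Context (R : nzRingType).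
Implicit Types (Y : 'M[R]_n).

Lemma coord_projE T i j : coord_proj R T i j = ((i == j) && (i \in T))%:R.
Proof. by rewrite !mxE; case: eqVneq => [->|]; rewrite ?mulr1n ?mulr0n. Qed.

Lemma mul_coord_projE m T (Y : 'M[R]_(n, m)) i j :
  (coord_proj R T *m Y) i j = (i \in T)%:R * Y i j.
Proof. by rewrite mul_diag_mx !mxE. Qed.

Lemma coord_proj_mulE m T (Y : 'M[R]_(m, n)) i j :
  (Y *m coord_proj R T) i j = Y i j * (j \in T)%:R.
Proof. by rewrite mul_mx_diag !mxE. Qed.

Lemma coord_proj_id T : coord_proj R T *m coord_proj R T = coord_proj R T.
Proof.
apply/matrixP=> i j; rewrite mul_coord_projE coord_projE -natrM mulnb.
by rewrite andbC -andbA andbb.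
Qed.

Lemma coord_projC T : coord_proj R T *m coord_proj R (~: T) = 0.
Proof.
apply/matrixP=> i j; rewrite mul_coord_projE coord_projE inE mxE -natrM mulnb.
by case: (i \in T); rewrite ?andbF.
Qed.

Lemma coord_projCl T : coord_proj R (~: T) *m coord_proj R T = 0.
Proof. by rewrite -{2}(setCK T) coord_projC. Qed.

Lemma coord_projD T : coord_proj R T + coord_proj R (~: T) = 1%:M.
Proof.
apply/matrixP=> i j; rewrite mxE !coord_projE inE !mxE.
by case: (i == j); case: (i \in T); rewrite ?addr0 ?add0r.
Qed.

Lemma tr_coord_proj T : (coord_proj R T)^T = coord_proj R T.
Proof. exact: tr_diag_mx. Qed.

End CoordProj.

Lemma map_coord_proj (R S : nzRingType) (f : {rmorphism R -> S}) T :
  map_mx f (coord_proj R T) = coord_proj S T.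
Proof. by apply/matrixP=> i j; rewrite mxE !coord_projE rmorph_nat. Qed.

Lemma intmx_normal_form (F : numFieldType) T X :
  intmx F (normal_form T X) = normal_form T (intmx F X).
Proof. by rewrite /intmx map_col_mx map_mxD !map_coord_proj. Qed.

(* The identity [D (D + X) + (1 - D) (1 - D) = 1] gives a left inverse. *)
Lemma mxrank_normal_form (F : fieldType) T (X : 'M[F]_n) :
  coord_proj F T *m X = 0 -> \rank (normal_form T X) = n.
Proof.
move=> TX; apply/eqP; rewrite eqn_leq rank_leq_col /=.
have e1 : row_mx (coord_proj F T) (coord_proj F (~: T)) *m normal_form T X = 1%:M.
  by rewrite mul_row_col mulmxDr !coord_proj_id TX addr0 coord_projD.
by have := mxrankM_maxr (row_mx (coord_proj F T) (coord_proj F (~: T)))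
  (normal_form T X); rewrite e1 mxrank1.
Qed.

Lemma normal_data_projl T X : normal_data T X -> coord_proj _ T *m X = 0.
Proof.
case=> _ _ _ h; apply/matrixP=> i j; rewrite mul_coord_projE !mxE.
by have [->|/h/negbTE->] := eqVneq (X i j) 0; rewrite ?mul0r ?mulr0.
Qed.

Lemma normal_data_projr T X : normal_data T X -> X *m coord_proj _ T = 0.
Proof.
move=> h; apply: trmx_inj; rewrite trmx_mul tr_coord_proj trmx0.
by case: (h) => -> *; apply: normal_data_projl.
Qed.

Lemma normal_data_projCr T X :
  normal_data T X -> X *m coord_proj _ (~: T) = X.
Proof.
move=> h; rewrite -{2}[X]mulmx1 -(coord_projD _ T) mulmxDr.
by rewrite (normal_data_projr h) add0r.
Qed.

Lemma normal_form_Omega0 T X :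
  normal_data T X -> in_Omega0 (normal_form T X).
Proof.
move=> hX; have [symX entX uniX supX] := hX.
have XC i j : X j i = X i j by rewrite -{1}symX mxE.
have tr1 : (coord_proj _ T + X)^T = coord_proj _ T + X.
  by rewrite linearD /= symX tr_coord_proj.
(* Rows indexed by [T] come from the identity alone, the others from [X] alone, so the two summands
   never interfere. *)
have top i j : (coord_proj int T + X) i j =
    if i \in T then (i == j)%:R else X i j.
  rewrite mxE coord_projE andbC; case: ifP => iT /=; last by rewrite add0r.
  by have [->|/supX] := eqVneq (X i j) 0; rewrite ?iT ?addr0.
have top_uni i j k : (coord_proj int T + X) i j != 0 ->
    (coord_proj int T + X) i k != 0 -> j = k.
  rewrite !top; case: ifP => _; last exact: uniX.
  by case: (eqVneq i j) => // <-; case: (eqVneq i k).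
exists (coord_proj _ T + X), (coord_proj _ (~: T)); split=> //.
- apply/and3P; split.
  + apply/forallP=> i; apply/forallP=> j; rewrite top; case: ifP => // _.
    by case: (i == j).
  + apply/'forall_'forall_'forall_implyP=> i j k /andP[h1 h2].
    by apply/eqP/(top_uni i).
  + apply/'forall_'forall_'forall_implyP=> j i k.
    rewrite -tr1 !(mxE _ _ _ j) => /andP[h1 h2].
    by apply/eqP/(top_uni j).
- apply/and3P; split.
  + by apply/forallP=> i; apply/forallP=> j; rewrite coord_projE; case: (_ && _).
  + apply/'forall_'forall_'forall_implyP=> i j k.
    rewrite !coord_projE.
    by case: (eqVneq i j) => // <-; case: (eqVneq i k) ; rewrite ?andbF.
  + apply/'forall_'forall_'forall_implyP=> j i k.
    rewrite !coord_projE.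
    by case: (eqVneq i j) => // ->; case: (eqVneq k j) ; rewrite ?andbF.
- rewrite trmx_mul trmxK tr1 tr_coord_proj mulmxDr mulmxDl.
  rewrite coord_projC coord_projCl !add0r (normal_data_projCr hX).
  by rewrite -[X in _ *m X]symX -[X in X *m _]tr_coord_proj -trmx_mul
    (normal_data_projCr hX).
- rewrite -/(intmx rat _) intmx_normal_form mxrank_normal_form //.
  by rewrite -(map_coord_proj (intr : {rmorphism int -> rat})) -map_mxM
    (normal_data_projl hX) map_mx0.
Qed.

End NormalForms.

(** * Reduction of the combinatorial side to normal forms *)

Section NormalFormOfOmega.
Context (n : nat).
Implicit Types (T : {set 'I_n}) (X t : 'M[int]_n).

Lemma sppP t :
  reflect [/\ forall i j, t i j \in [:: -1; 0; 1],
              forall i j k, t i j != 0 -> t i k != 0 -> j = k &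
              forall i j k, t i j != 0 -> t k j != 0 -> i = k]
          (is_spp t).
Proof.
apply: (iffP and3P) => [[h1 h2 h3] | [h1 h2 h3]]; split.
- by move=> i j; move/forallP/(_ i)/forallP/(_ j): h1.
- move=> i j k tj tk.
  by move/'forall_'forall_'forall_implyP/(_ i j k): h2; rewrite tj tk => /(_ isT)/eqP.
- move=> i j k ti tk.
  by move/'forall_'forall_'forall_implyP/(_ j i k): h3; rewrite ti tk => /(_ isT)/eqP.
- by apply/forallP=> i; apply/forallP.
- apply/'forall_'forall_'forall_implyP=> i j k /andP[h4 h5].
  by apply/eqP/(h2 i).
- apply/'forall_'forall_'forall_implyP=> j i k /andP[h4 h5].
  by apply/eqP/(h3 _ j).
Qed.

(* If row [i] of [t2] vanishes, then [e_i] is orthogonal to the Lagrangian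
   subspace, hence lies in it; this forces a column supported at [e_i] only. *)
Lemma Omega0_top_column t1 t2 i :
  is_spp t1 -> is_spp t2 -> (t1^T *m t2)^T = t1^T *m t2 ->
  \rank (intmx rat (omega t1 t2)) = n ->
  (forall j, t2 i j = 0) ->
  exists j, t1 i j != 0 /\ forall k, t2 k j = 0.
Proof.
move=> /sppP[_ r1 _] /sppP[_ r2 _] sym rk t2i.
pose f : {rmorphism rat -> rat} := idfun.
have L : lagrangian f (Sigma_mx rat n) (intmx rat (omega t1 t2)).
  exact: intmx_lagrangian.
pose V : 'M[rat]_(n + n, 1) := col_mx (delta_mx i 0) 0.
have [|Z] := lagrangian_max (V := V) L.
  rewrite {1}/intmx map_col_mx Sigma_col mulmx0 sub0r -!/(intmx _ _) adj_intmx.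
  apply/matrixP=> j k; rewrite !mxE big1 ?oppr0 // => l _.
  by rewrite !mxE; case: eqVneq => [->|_]; rewrite ?t2i ?mul0r ?mulr0.
rewrite /intmx map_col_mx mul_col_mx => /eq_col_mx[e1 e2].
have row_sum t l : (forall i j k, t i j != 0 -> t i k != 0 -> j = k) ->
    forall j, t l j != 0 -> (map_mx (intr : int -> rat) t *m Z) l 0 =
    (t l j)%:~R * Z j 0.
  move=> r j tj; rewrite mxE (bigD1 j) //= big1 ?addr0 ?mxE // => k kj.
  rewrite mxE; have [->|tk] := eqVneq (t l k) 0; first by rewrite mul0r.
  by rewrite (r _ _ _ tk tj) eqxx in kj.
have /existsP[j tj] : [exists j, t1 i j != 0].
  apply: contraT; rewrite negb_exists => /forallP h.
  have /matrixP/(_ i 0) := e1; rewrite !mxE !eqxx big1 => [/eqP|k _].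
    by rewrite oner_eq0.
  by have := h k; rewrite negbK mxE => /eqP->; rewrite mul0r.
(* Row [i] of the top block reads [t1 i j * Z j 0 = 1], whereas a nonzero [t2 k j] would force
   [Z j 0 = 0] in row [k] of the bottom block. *)
exists j; split=> // k; apply/eqP; apply: contraT => tk.
have /matrixP/(_ i 0) := e1; rewrite (row_sum _ _ r1 j tj) mxE !eqxx.
have -> : Z j 0 = 0.
  have /matrixP/(_ k 0) := e2; rewrite [LHS]mxE (row_sum _ _ r2 j tk).
  by move/esym/eqP; rewrite mulf_eq0 intr_eq0 (negbTE tk) => /eqP.
by rewrite mulr0 => /eqP; rewrite oner_eq0.
Qed.

Lemma mulmx_signed_perm m (A : 'M[int]_(m, n)) (e : {ffun 'I_n -> bool})
    (p : 'S_n) i j :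
  (A *m (sign_diag e *m perm_mx p^-1)) i j = A i (p j) * (-1) ^+ e (p j).
Proof. by rewrite mulmxA -col_permE mxE mul_mx_diag !mxE. Qed.

(** Each row [i] receives a pivot column [p i], in the top block if [i] is in [T] and in the bottom
    block otherwise. The pivots are distinct, so a signed permutation of the columns moves the pivot
    of row [i] to column [i] and makes it [1]. *)
Lemma Omega0_normal_form w : in_Omega0 w ->
  exists T X, normal_data T X /\ Omega_equiv w (normal_form T X).
Proof.
case=> t1 [t2 [-> s1 s2 sym rk]].
have /sppP[v1 r1 c1] := s1; have /sppP[v2 r2 c2] := s2.
pose T := [set i | [forall j, t2 i j == 0]].
have pivot i : exists j, if i \in T then t1 i j != 0 /\ forall k, t2 k j = 0
                         else t2 i j != 0.
  case: (boolP (i \in T)); rewrite inE.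
    by move=> /forallP h; apply: (Omega0_top_column s1 s2) => // j; apply/eqP.
  by rewrite negb_forall => /existsP.
have [p hp] := fin_all_exists pivot.
(* Two pivots in the same block differ because its columns have at most one nonzero entry. In the
   mixed cases, the pivot column of a row in [T] vanishes in the bottom block, while the other one
   does not. *)
have p_inj : injective p.
  move=> i j eij; have := hp i; have := hp j; rewrite -eij.
  case: ifP => _; case: ifP => _.
  - by move=> [hj _] [hi _]; apply: c1 hi hj.
  - by move=> [_ ->]; rewrite eqxx.
  - by move=> + [_ h]; rewrite h eqxx.
  - by move=> hj hi; apply: c2 hi hj.
pose q := perm p_inj.
pose tt i := if i \in T then t1 else t2.
(* Signs are indexed by the original columns, since [sign_diag e] acts before the permutation; [e k]
   records whether the pivot in column [k] is [-1]. *)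
pose e := [ffun k => tt ((q^-1)%g k) ((q^-1)%g k) k == -1].
pose s := sign_diag e *m perm_mx q^-1.
have sE m (A : 'M[int]_(m, n)) i j :
    (A *m s) i j = A i (p j) * (-1) ^+ (tt j j (p j) == -1).
  by rewrite mulmx_signed_perm ffunE permK permE.
have s_eq0 m (A : 'M[int]_(m, n)) i j : ((A *m s) i j == 0) = (A i (p j) == 0).
  by rewrite sE mulf_eq0 signr_eq0 orbF.
have s_pivot i : (tt i *m s) i i = 1.
  have : tt i i (p i) \in [:: -1; 0; 1] by rewrite /tt; case: ifP.
  have : tt i i (p i) != 0.
    by have := hp i; rewrite /tt; case: ifP => _ //; case.
  by rewrite sE !inE => /negbTE-> /= /orP[] /eqP->.
have bottom : t2 *m s = coord_proj _ (~: T).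
  apply/matrixP=> i j; rewrite coord_projE inE.
  have := hp j; have := s_pivot j; rewrite /tt.
  case: ifP => jT sj hj.
    by rewrite sE (proj2 hj) mul0r; case: eqVneq => // ->; rewrite jT.
  have [->|ij] := eqVneq i j; first by rewrite jT.
  apply/eqP; rewrite s_eq0; apply: contraNT ij => ti.
  by apply/eqP/(c2 _ _ _ ti hj).
pose X : 'M[int]_n := \matrix_(i, j) if j \in T then 0 else (t1 *m s) i j.
have top : t1 *m s = coord_proj _ T + X.
  apply/matrixP=> i j; rewrite [RHS]mxE coord_projE [X i j]mxE.
  have := hp j; have := s_pivot j; rewrite /tt.
  case: ifP => jT sj hj; last first.
    by case: eqVneq => [->|_]; rewrite ?jT add0r.
  rewrite addr0; have [->|ij] := eqVneq i j; first by rewrite jT.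
  apply/eqP; rewrite s_eq0; apply: contraNT ij => ti.
  by apply/eqP/(c1 _ _ _ ti (proj1 hj)).
(* The only nonzero entry in a row [i] of [T] is its pivot, which now sits in column [i], a column
   erased from [X]. *)
have suppX i j : X i j != 0 -> i \notin T.
  rewrite mxE; case: ifP => [_|jT]; first by rewrite eqxx.
  rewrite s_eq0 => tj; apply/negP=> iT.
  have := hp i; rewrite iT => -[ti _].
  by rewrite -(p_inj _ _ (r1 _ _ _ ti tj)) iT in jT.
have s_perm : is_signed_perm s by exists e, (q^-1)%g.
clearbody s; exists T, X; split; last first.
  exists [ffun=> false], s; split=> //.
  rewrite /omega /normal_form -top -bottom mul_block_col !mul0mx addr0 add0r.
  have -> : sign_diag [ffun=> false] = 1%:M :> 'M_n.
    by apply/matrixP=> i j; rewrite !mxE ffunE.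
  by rewrite !mul1mx mul_col_mx.
split=> //.
- have : ((t1 *m s)^T *m (t2 *m s))^T = (t1 *m s)^T *m (t2 *m s).
    have -> : (t1 *m s)^T *m (t2 *m s) = s^T *m (t1^T *m t2) *m s.
      by rewrite trmx_mul !mulmxA.
    by rewrite trmx_mul trmx_mul sym trmxK !mulmxA.
  rewrite top bottom linearD /= tr_coord_proj mulmxDl coord_projC add0r.
  suff -> : X^T *m coord_proj _ (~: T) = X^T by rewrite trmxK.
  apply/matrixP=> i j; rewrite coord_proj_mulE inE [X^T i j]mxE.
  by have [->|/suppX->] := eqVneq (X j i) 0; rewrite ?mul0r ?mulr1.
- move=> i j; rewrite mxE; case: ifP => // _; rewrite sE.
  by have := v1 i (p j); case: (tt j j (p j) == -1); rewrite !inE => /or3P[] /eqP->.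
- move=> i j k; rewrite [X i j]mxE [X i k]mxE; case: ifP => _; first by rewrite eqxx.
  case: ifP => _; first by rewrite eqxx.
  by rewrite !s_eq0 => tj tk; rewrite (p_inj _ _ (r1 _ _ _ tj tk)).
Qed.

(** Conjugation by a sign matrix fixes the coordinate projections and the diagonal of [X], but can
    flip any symmetric pair of off-diagonal entries. *)
Lemma normal_form_Omega_equiv T X X' :
  normal_data T X -> normal_data T X' ->
  (forall i j, (X i j != 0) = (X' i j != 0)) -> (forall i, X i i = X' i i) ->
  Omega_equiv (normal_form T X) (normal_form T X').
Proof.
move=> [sX vX rX _] [sX' vX' rX' _] supp dg.
have XC i j : X i j = X j i by rewrite -{1}sX mxE.
have XC' i j : X' i j = X' j i by rewrite -{1}sX' mxE.
(* For a pair [i < j] whose entries differ, the flip is placed at the smaller index only. The larger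
   index stays unflipped because its single nonzero entry lies in column [i]. *)
pose e := [ffun i : 'I_n => [exists j : 'I_n, (i < j)%N && (X i j != X' i j)]].
have e_lt (i j : 'I_n) : X i j != 0 -> (i < j)%N ->
    e i = (X i j != X' i j) /\ e j = false.
  move=> Xij ij; split; rewrite ffunE.
    apply/existsP/idP=> [[k /andP[_ d]]|d]; last by exists j; rewrite ij.
    suff -> : j = k by [].
    apply: rX Xij _; apply: contraNneq d => h; rewrite h eq_sym.
    by have := supp i k; rewrite h eqxx => /esym/negbFE.
  apply/existsP=> -[k /andP[jk d]].
  have Xjk : X j k != 0.
    apply: contraNneq d => h; rewrite h eq_sym.
    by have := supp j k; rewrite h eqxx => /esym/negbFE.
  rewrite XC in Xij; have ik := rX _ _ _ Xij Xjk.
  by have := ltn_trans ij jk; rewrite ik ltnn.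
have eq_lt (i j : 'I_n) : (i < j)%N -> X' i j = (-1) ^+ e i * X i j * (-1) ^+ e j.
  move=> ij; have := supp i j; have [-> /esym/negbFE/eqP->|Xij X'ij] := eqVneq (X i j) 0.
    by rewrite mulr0 mul0r.
  have [-> ->] := e_lt _ _ Xij ij; rewrite mulr1.
  have [->|d] := eqVneq (X i j) (X' i j); first by rewrite mul1r.
  have := vX i j; have := vX' i j; move: d Xij X'ij; rewrite !inE.
  by move=> d x x' /or3P[] /eqP x'E /or3P[] /eqP xE; move: d x x'; rewrite xE x'E.
have eqX : X' = sign_diag e *m X *m sign_diag e.
  apply/matrixP=> i j; rewrite mul_mx_diag mxE mul_diag_mx !mxE.
  case: (ltngtP i j) => [/eq_lt//|/eq_lt h|/val_inj->].
    by rewrite XC' h XC [LHS]mulrC [X in _ * X]mulrC mulrA.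
  by rewrite -dg mulrAC -expr2 sqrr_sign mul1r.
have eqT U : coord_proj _ U = sign_diag e *m coord_proj _ U *m sign_diag e.
  apply/matrixP=> i j; rewrite [LHS]coord_projE mul_mx_diag [RHS]mxE mul_diag_mx.
  rewrite [X in _ = X * _]mxE coord_projE !mxE.
  case: eqVneq => [->|_]; last by rewrite mulr0 mul0r.
  by rewrite mulrAC -expr2 sqrr_sign mul1r.
exists e, (sign_diag e); split; first exact: signed_perm_sign_diag.
rewrite /normal_form mul_block_col !mul0mx addr0 add0r mul_col_mx -eqT.
by rewrite mulmxDr mulmxDl -eqX -eqT.
Qed.

End NormalFormOfOmega.

(** * Well-definedness of the map to [B_H]-orbits *)

Section OmegaToBorel.
Context (F : numFieldType) (conj : {rmorphism F -> F}) (n : nat).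

Lemma intmx_sign_diag_sqr (e : {ffun 'I_n -> bool}) :
  intmx F (sign_diag e) *m intmx F (sign_diag e) = 1%:M.
Proof. by rewrite -intmxM sign_diag_sqr /intmx map_mx1. Qed.

(** A sign matrix is upper triangular and equals the inverse of its own adjoint, so the left sign
    action is an action of [B_H]. Right multiplication by an invertible matrix only changes the
    basis of the column space. *)
Lemma Omega_equiv_BH (w w' : 'M[int]_(n + n, n)) :
  Omega_equiv w w' -> BH_equiv conj (intmx F w) (intmx F w').
Proof.
case=> e [s [/signed_perm_inv[s' [_ ss']] ->]].
have [ue _] := mulmx1_unit (intmx_sign_diag_sqr e).
exists (intmx F (sign_diag e)); split=> //.
  apply/upper_triP=> i j ji; rewrite !mxE -val_eqE /= gtn_eqF //.
have -> : H_elt conj (intmx F (sign_diag e)) =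
    intmx F (block_mx (sign_diag e) 0 0 (sign_diag e)).
  rewrite /H_elt adj_intmx tr_diag_mx /intmx map_block_mx !map_mx0.
  congr block_mx; rewrite -[LHS]mulmx1 -(intmx_sign_diag_sqr e).
  by rewrite mulKmx.
rewrite !intmxM; apply/same_colspace_sym/same_colspace_mulr.
by case: (mulmx1_unit (B := intmx F s') (A := intmx F s)); rewrite // -intmxM ss' /intmx map_mx1.
Qed.

End OmegaToBorel.

(** * Injectivity: comparison of normal forms in one [B_H]-orbit *)

Section Uniqueness.
Context (F : numFieldType) (conj : {rmorphism F -> F}) (n : nat).
Hypothesis conj_norm_neqN1 : forall c : F, c * conj c != -1.
Implicit Types (T : {set 'I_n}) (X : 'M[int]_n).
Local Notation nf T X := (intmx F (normal_form T X)).
Local Notation P T := (coord_proj F T).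

Lemma BH_normal_formP T T' X X' : BH_equiv conj (nf T X) (nf T' X') ->
  exists b g : 'M[F]_n,
    [/\ upper_tri b, b \in unitmx,
        b *m (P T + intmx F X) = (P T' + intmx F X') *m g &
        adj_mx conj (invmx b) *m P (~: T) = P (~: T') *m g].
Proof.
case=> b [tb ub /same_colspaceP[g]].
rewrite !intmx_normal_form H_elt_col mul_col_mx => /eq_col_mx[e1 e2].
by exists b, g; split; rewrite ?adj_mx_inv.
Qed.

Lemma intmx_projr T X : normal_data T X -> intmx F X *m P (~: T) = intmx F X.
Proof.
by move=> /normal_data_projCr h; rewrite -{2}h intmxM /intmx map_coord_proj.
Qed.

Lemma intmx_projl T X : normal_data T X -> P (~: T) *m intmx F X = intmx F X.
Proof.
move=> h; apply: trmx_inj; rewrite trmx_mul tr_coord_proj /intmx map_trmx.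
by case: (h) => -> _ _ _; apply: intmx_projr.
Qed.

Lemma intmx_proj0 T X : normal_data T X -> intmx F X *m P T = 0.
Proof. by move=> h; rewrite -(intmx_projr h) -mulmxA coord_projCl mulmx0. Qed.

Lemma BH_normal_form_sub T T' X X' : normal_data T X -> normal_data T' X' ->
  BH_equiv conj (nf T X) (nf T' X') -> T \subset T'.
Proof.
move=> hX hX' /BH_normal_formP[b [g [tb ub e1 e2]]].
(* This block of [b] equals [X' *m g *m P T]. Since [X'] sees only the rows of [g] outside [T'], the
   bottom equation turns it into a multiple of [P (~: T) *m P T = 0]. A diagonal entry of [b] in
   this block would contradict invertibility. *)
have e0 : P (~: T') *m b *m P T = 0.
  rewrite -mulmxA; have -> : b *m P T = b *m (P T + intmx F X) *m P T.
    by rewrite -[RHS]mulmxA mulmxDl coord_proj_id (intmx_proj0 hX) addr0.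
  rewrite e1 !mulmxA mulmxDr coord_projCl add0r (intmx_projl hX').
  rewrite -(intmx_projr hX') -(mulmxA _ _ g) -e2 -!mulmxA coord_projCl.
  by rewrite !mulmx0.
apply/subsetP=> j jT; apply: contraT => jT'.
have /matrixP/(_ j j) := e0; rewrite coord_proj_mulE mul_coord_projE inE jT jT'.
by rewrite mul1r mulr1 mxE => /eqP; rewrite (negbTE (upper_tri_unitP tb ub j)).
Qed.

(* Read off from [b X = X' c] outside [T], with [b] upper and [c] lower
   triangular. *)
Lemma BH_normal_form_pivot T X X' : normal_data T X -> normal_data T X' ->
  BH_equiv conj (nf T X) (nf T X') ->
  forall i j, X i j != 0 ->
  exists k : 'I_n, [/\ (j <= k)%N, X' i k != 0 & i = j -> j = k -> X i i = X' i i].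
Proof.
move=> hX hX' /BH_normal_formP[b [g [tb ub e1 e2]]] i j Xij.
have [symX vX uX sX] := hX; have [symX' vX' uX' sX'] := hX'.
have XC i' j' : X i' j' = X j' i' by rewrite -{1}symX mxE.
set c := adj_mx conj (invmx b) in e2.
have e3 : P (~: T) *m (b *m intmx F X) = intmx F X' *m c *m P (~: T).
  have -> : b *m intmx F X = b *m (P T + intmx F X) *m P (~: T).
    by rewrite -[RHS]mulmxA mulmxDl coord_projC add0r intmx_projr.
  rewrite e1 !mulmxA mulmxDr coord_projCl add0r (intmx_projl hX').
  by rewrite -{1}(intmx_projr hX') -(mulmxA _ _ g) -e2 -!mulmxA coord_proj_id.
have iT : i \in ~: T by rewrite inE (sX _ _ Xij).
have jT : j \in ~: T by rewrite inE; apply: (sX j i); rewrite XC.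
have e4 : (b *m intmx F X) i j = (intmx F X' *m c) i j.
  by have /matrixP/(_ i j) := e3; rewrite mul_coord_projE coord_proj_mulE iT jT mul1r mulr1.
have bi0 := upper_tri_unitP tb ub i.
(* Column [j] of [X] and row [i] of [X'] have at most one nonzero entry each, so both products
   collapse to one term: [b i i * X i j = X' i k * c k j]. As [c] is lower triangular, this forces
   [j <= k]. *)
have e5 : (b *m intmx F X) i j = b i i * (X i j)%:~R.
  rewrite mxE (bigD1 i) //= big1 ?addr0 ?mxE // => k ki; rewrite mxE.
  have [->|Xkj] := eqVneq (X k j) 0; first by rewrite mulr0.
  by rewrite XC in Xkj; rewrite XC in Xij; rewrite (uX _ _ _ Xkj Xij) eqxx in ki.
have row_sum k : X' i k != 0 -> (intmx F X' *m c) i j = (X' i k)%:~R * c k j.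
  move=> X'ik; rewrite mxE (bigD1 k) //= big1 ?addr0 ?mxE // => l lk; rewrite mxE.
  have [->|X'il] := eqVneq (X' i l) 0; first by rewrite mul0r.
  by rewrite (uX' _ _ _ X'il X'ik) eqxx in lk.
have nz : (intmx F X' *m c) i j != 0.
  by rewrite -e4 e5 mulf_neq0 // intr_eq0.
have [k X'ik] : exists k, X' i k != 0.
  apply/existsP; apply: contraNT nz; rewrite negb_exists => /forallP h.
  rewrite mxE big1 // => k _; have := h k; rewrite negbK mxE => /eqP->.
  by rewrite mul0r.
have e6 := row_sum k X'ik; exists k; split=> //.
  rewrite leqNgt; apply: contra nz => kj.
  by rewrite e6 !mxE (upper_triP _ (upper_tri_invmx tb ub)) // rmorph0 mulr0.
move=> eij ejk; subst j k.
(* The diagonal entry of [c] is the inverse of [conj (b i i)]. Opposite signs in [X] and [X'] would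
   thus make [b i i * conj (b i i)] equal to [-1]. *)
have e7 : b i i * conj (b i i) * (X i i)%:~R = (X' i i)%:~R.
  rewrite mulrAC -e5 e4 e6 !mxE invmx_diag_upper_tri // -mulrA -rmorphM mulVf //.
  by rewrite rmorph1 mulr1.
move: e7 Xij X'ik; have := vX i i; have := vX' i i; rewrite !inE.
have /eqP nb := conj_norm_neqN1 (b i i).
move=> /or3P[] /eqP-> /or3P[] /eqP-> //.
- by rewrite mulr1 => /nb.
- by move/eqP; rewrite mulrN1 eqr_oppLR => /eqP/nb.
Qed.

Lemma BH_normal_form_inj T T' X X' : normal_data T X -> normal_data T' X' ->
  BH_equiv conj (nf T X) (nf T' X') ->
  Omega_equiv (normal_form T X) (normal_form T' X').
Proof.
move=> hX hX' BH; have BH' := BH_equiv_sym BH.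
have eT : T = T'.
  by apply/eqP; rewrite eqEsubset (BH_normal_form_sub hX hX' BH)
    (BH_normal_form_sub hX' hX BH').
subst T'; have [_ _ uX _] := hX; have [_ _ uX' _] := hX'.
have pv := BH_normal_form_pivot hX hX' BH.
have pv' := BH_normal_form_pivot hX' hX BH'.
(* Passing from [X] to [X'] and back moves the column weakly to the right twice. It returns to the
   unique nonzero column of row [i], so neither move is strict. *)
have supp i j : X i j != 0 -> X' i j != 0.
  move=> Xij; have [k [jk X'ik _]] := pv _ _ Xij.
  have [l [kl Xil _]] := pv' _ _ X'ik; rewrite (uX _ _ _ Xij Xil) in jk *.
  by suff -> : l = k by []; apply/val_inj/anti_leq; rewrite jk kl.
have supp' i j : X' i j != 0 -> X i j != 0.
  move=> Xij; have [k [jk X'ik _]] := pv' _ _ Xij.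
  have [l [kl Xil _]] := pv _ _ X'ik; rewrite (uX' _ _ _ Xij Xil) in jk *.
  by suff -> : l = k by []; apply/val_inj/anti_leq; rewrite jk kl.
apply: normal_form_Omega_equiv => // [i j|i].
  by apply/idP/idP; [apply: supp | apply: supp'].
have [Xii|Xii] := eqVneq (X i i) 0; last first.
  have [k [_ X'ik]] := pv _ _ Xii; apply=> //.
  exact: uX' (supp _ _ Xii) X'ik.
rewrite Xii; apply/esym/eqP; apply: contraT => /supp'; by rewrite Xii eqxx.
Qed.

End Uniqueness.

(** * Hermitian matrices under upper triangular congruence *)

Section HermitianCongruence.
Context (F : numFieldType) (conj : {rmorphism F -> F}) (n : nat).
Hypothesis conjK : involutive conj.
Hypothesis conj_norm : forall x : F, conj x = x -> x != 0 ->
  exists c, c != 0 /\ (c * x * conj c = 1 \/ c * x * conj c = -1).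
Implicit Types (X Y Z : 'M[F]_n) (S : {set 'I_n}).
Local Notation adj := (adj_mx conj).

(** This is the action of [B_H] on graphs [[X ; 1]]: right multiplication by [adj b] turns
    [[b *m X ; invmx (adj b)]] into [[b *m X *m adj b ; 1]]. *)
Definition borel_congr X Y : Prop :=
  exists b, [/\ upper_tri b, b \in unitmx & Y = b *m X *m adj b].

Definition monomial_rows S X : Prop :=
  forall i j k, i \in S -> X i j != 0 -> X i k != 0 -> j = k.

Lemma borel_congr_refl X : borel_congr X X.
Proof.
exists 1%:M; rewrite unitmx1 adj_mx1 mul1mx mulmx1; split=> //.
by apply/upper_triP=> i j ji; rewrite mxE -val_eqE /= gtn_eqF.
Qed.

Lemma borel_congr_trans X Y Z :
  borel_congr X Y -> borel_congr Y Z -> borel_congr X Z.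
Proof.
move=> [b [tb ub ->]] [c [tc uc ->]]; exists (c *m b).
by rewrite upper_triM // unitmx_mul uc ub adj_mxM !mulmxA.
Qed.

Lemma borel_congr_herm X Y : adj X = X -> borel_congr X Y -> adj Y = Y.
Proof.
by move=> hX [b [_ _ ->]]; rewrite !adj_mxM (adj_mxK conjK) hX mulmxA.
Qed.

Lemma herm_entry X i j : adj X = X -> X i j = conj (X j i).
Proof. by move=> hX; rewrite -{1}hX !mxE. Qed.

Lemma herm_entry_eq0 X i j : adj X = X -> (X i j == 0) = (X j i == 0).
Proof. by move=> hX; rewrite (herm_entry _ _ hX) fmorph_eq0. Qed.

(** Congruence by the identity plus [u] placed in column [j]. The vector [u] lives strictly above
    row [j], so this matrix is upper unitriangular. *)
Lemma borel_congr_elementary X (j : 'I_n) (u : 'I_n -> F) :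
  (forall i : 'I_n, (j <= i)%N -> u i = 0) ->
  exists Y, borel_congr X Y /\ forall i k,
    Y i k = X i k + u i * X j k + X i j * conj (u k) + u i * X j j * conj (u k).
Proof.
move=> hu; pose U : 'cV[F]_n := \col_i u i.
pose b := 1%:M + U *m (delta_mx 0 j : 'rV_n).
have bE i k : b i k = (i == k)%:R + u i * (k == j)%:R.
  by rewrite !mxE big_ord1 !mxE eqxx.
have tb : upper_tri b.
  apply/upper_triP=> i k ki; rewrite bE -val_eqE /= gtn_eqF // add0r.
  by case: eqVneq => [kj|_]; rewrite ?mulr0 // hu ?mul0r // -kj ltnW.
exists (b *m X *m adj b); split.
  exists b; split=> //; apply/(upper_tri_unitP tb)=> i; rewrite bE eqxx.
  by case: (eqVneq i j) => [->|_]; rewrite ?(hu j) // ?mul0r ?mulr0 addr0 oner_eq0.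
move=> i k; have -> : b *m X = X + U *m row j X.
  by rewrite mulmxDl mul1mx -mulmxA -rowE.
have -> (A : 'M_n) : A *m adj b = A + col j A *m adj U.
  rewrite adj_mxD adj_mx1 adj_mxM mulmxDr mulmx1 colE mulmxA.
  by congr (_ + _ *m _ *m _); apply/matrixP=> l m; rewrite !mxE rmorph_nat andbC.
by rewrite !mxE !big_ord1 !mxE !big_ord1 !mxE mulrDl addrA.
Qed.

(* [S] is the set of indices already processed. *)
Lemma herm_monomial_step S X : adj X = X -> monomial_rows S X ->
    (forall i k, i \in S -> k \notin S -> X i k = 0) ->
    (exists i, i \notin S) ->
  exists S' Y, [/\ S \proper S', borel_congr X Y, monomial_rows S' Y &
    forall i k, i \in S' -> k \notin S' -> Y i k = 0].
Proof.
move=> hX mX oX [i0 hi0].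
have oX' i k : i \notin S -> k \in S -> X i k = 0.
  by move=> hi hk; apply/eqP; rewrite herm_entry_eq0 // oX.
(* The largest unprocessed index [m] is chosen, so that every later index is already split off and
   row operations from [m] only need to reach upwards. *)
case: (@arg_maxnP _ i0 [pred i | i \notin S] val hi0) => m /= mS m_max.
have gtmS (i : 'I_n) : (m < i)%N -> i \in S.
  by move=> mi; apply: contraT => /m_max; rewrite /= leqNgt mi.
have [/existsP[j0 hj0]|] := boolP [exists k, X m k != 0]; last first.
  rewrite negb_exists => /forallP h.
  have Xm k : X m k = 0 by apply/eqP; have := h k; rewrite negbK.
  exists (m |: S), X; split.
  - by rewrite properE subsetUr /=; apply/subsetPn; exists m; rewrite ?setU11.
  - exact: borel_congr_refl.
  - move=> i j k /setU1P[->|iS]; first by rewrite Xm eqxx.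
    exact: mX.
  - move=> i k /setU1P[->|iS] //; rewrite !inE negb_or => /andP[_ kS].
    exact: oX.
case: (@arg_maxnP _ j0 [pred k | X m k != 0] val hj0) => j /= Xmj j_max.
have jS : j \notin S by apply: contraNN Xmj => jS; rewrite oX'.
have jm : (j <= m)%N by have := m_max j jS.
have Xm_gt (i : 'I_n) : (j < i)%N -> X i m = 0.
  move=> ji; apply/eqP; rewrite herm_entry_eq0 //; apply: contraTT ji => h.
  by rewrite -leqNgt; apply: (j_max i).
have Xjm : X j m != 0 by rewrite herm_entry_eq0.
(* Column [m] is cleared with [X j m] as pivot. Maximality of [j] means that the rows below [j]
   already vanish there, so only upward operations occur. *)
pose u i := if i == j then 0 else - (X i m / X j m).
have u_ge (i : 'I_n) : (j <= i)%N -> u i = 0.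
  rewrite /u; case: eqVneq => // ij ji; rewrite Xm_gt ?mul0r ?oppr0 //.
  by rewrite ltn_neqAle eq_sym ij.
have uS i : i \in S -> u i = 0.
  by move=> iS; rewrite /u oX // mul0r oppr0 if_same.
have um : u m = 0 by apply: u_ge.
have [Y [XY YE]] := borel_congr_elementary X u_ge.
have hY := borel_congr_herm hX XY.
have YS i k : i \in S -> Y i k = X i k.
  by move=> iS; rewrite YE uS // (oX i j) // !mul0r !addr0.
have Yim i : i != j -> Y i m = 0.
  move=> ij; rewrite YE um rmorph0 !mulr0 !addr0 /u (negbTE ij).
  by rewrite mulNr divfK // subrr.
have Yjm : Y j m = X j m by rewrite YE um rmorph0 !mulr0 !addr0 /u eqxx mul0r addr0.
have Ymk k : Y m k != 0 -> k = j.
  by rewrite herm_entry_eq0 // => h; apply: contraNeq h => /Yim->.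
(* If [j = m] the pivot is diagonal and a line splits off. Otherwise [Y m m = 0], and clearing
   column [j] as well splits off the hyperbolic plane on [j] and [m]. *)
have [ejm|njm] := eqVneq j m.
  exists (m |: S), Y; split=> //.
  - by rewrite properE subsetUr /=; apply/subsetPn; exists m; rewrite ?setU11.
  - move=> i k l /setU1P[-> /Ymk-> /Ymk->//|iS]; rewrite !YS //; exact: mX.
  - move=> i k; rewrite !inE negb_or => /predU1P[->|iS] /andP[km kS].
      by apply/eqP; apply: contraNT km => /Ymk->; rewrite ejm.
    by rewrite YS // oX.
have Ymj : Y m j != 0 by rewrite herm_entry_eq0 // Yjm.
have Ymm : Y m m = 0 by apply: Yim; rewrite eq_sym.
(* The factor [2^-1] occurs at [i = j] because the diagonal entry [Y j j] is changed twice, once by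
   the row operation and once by its conjugate column operation. *)
pose v i := if i == m then 0 else
            - (Y i j / Y m j) * (if i == j then 2^-1 else 1).
have vS i : i \in S -> v i = 0.
  by move=> iS; rewrite /v YS // oX // !mul0r oppr0 mul0r if_same.
have v_ge (i : 'I_n) : (m <= i)%N -> v i = 0.
  rewrite leq_eqVlt => /predU1P[/val_inj<-|/gtmS/vS//].
  by rewrite /v eqxx.
have [Z [YZ ZE]] := borel_congr_elementary Y v_ge.
have hZ := borel_congr_herm hY YZ.
have ZS i k : i \in S -> Z i k = X i k.
  move=> iS; rewrite ZE vS // (Yim i) ?mul0r ?addr0 ?YS //.
  by apply: contraTneq iS => ->.
have Zim i : i != j -> Z i m = 0.
  by move=> ij; rewrite ZE Ymm Yim // !(mulr0, mul0r, addr0).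
have Zij i : i != m -> Z i j = 0.
  move=> im; rewrite ZE Ymm mulr0 mul0r addr0 /v (negbTE im) (negbTE njm).
  case: (eqVneq i j) => [->|ij]; last first.
    by rewrite Yim // mul0r addr0 mulr1 mulNr divfK // subrr.
  rewrite eqxx (herm_entry j m hY) -rmorphM [Y m j * _]mulrC.
  have -> : - (Y j j / Y m j) / 2 * Y m j = - (Y j j / 2).
    by rewrite mulrAC mulNr divfK // mulNr.
  rewrite rmorphN rmorphM -herm_entry // fmorphV rmorph_nat.
  by rewrite -addrA -opprD -splitr subrr.
have Zmk k : Z m k != 0 -> k = j.
  by rewrite herm_entry_eq0 // => h; apply: contraNeq h => /Zim->.
have Zjk k : Z j k != 0 -> k = m.
  by rewrite herm_entry_eq0 // => h; apply: contraNeq h => /Zij->.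
exists (m |: (j |: S)), Z; split.
- rewrite properE setUA subsetUr /=; apply/subsetPn.
  by exists m; rewrite // !inE eqxx.
- exact: borel_congr_trans XY YZ.
- move=> i k l; rewrite !inE => /or3P[/eqP->|/eqP->|iS].
  + by move=> /Zmk-> /Zmk->.
  + by move=> /Zjk-> /Zjk->.
  + by rewrite !ZS //; apply: mX.
- move=> i k; rewrite !inE !negb_or => hi /and3P[km kj kS].
  case/or3P: hi => [/eqP->|/eqP->|iS].
  + by apply/eqP; apply: contraNT kj => /Zmk->.
  + by apply/eqP; apply: contraNT km => /Zjk->.
  + by rewrite ZS // oX.
Qed.

Lemma herm_monomial X : adj X = X ->
  exists Y, borel_congr X Y /\ monomial_rows setT Y.
Proof.
move=> hX; suff H m S Z : (#|~: S| <= m)%N -> adj Z = Z -> monomial_rows S Z ->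
    (forall i k, i \in S -> k \notin S -> Z i k = 0) ->
    exists Y, borel_congr Z Y /\ monomial_rows setT Y.
  by apply: (H _ set0 X (leqnn _)) => // [i j k|i k]; rewrite in_set0.
elim: m S Z => [|m IH] S Z cS hZ mZ oZ.
  exists Z; split; first exact: borel_congr_refl.
  move: cS; rewrite leqn0 cards_eq0 -setCT (inj_eq (can_inj (@setCK _))).
  by move/eqP=> eS; rewrite -eS.
have [/existsP ex|] := boolP [exists i, i \notin S]; last first.
  rewrite negb_exists => /forallP h; exists Z; split; first exact: borel_congr_refl.
  by move=> i j k _; apply: mZ; have := h i; rewrite negbK.
have [S' [Y [SS' ZY mY oY]]] := herm_monomial_step hZ mZ oZ ex.
have [||W [YW mW]] := IH S' Y _ _ mY oY.
- rewrite -ltnS; apply: leq_trans cS; apply: proper_card.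
  by rewrite properE !setCS -properE.
- exact: borel_congr_herm ZY.
- by exists W; split=> //; apply: borel_congr_trans ZY YW.
Qed.

Lemma herm_normal_form X : adj X = X ->
  exists Z, [/\ borel_congr X Z, monomial_rows setT Z &
    forall i j, Z i j \in [:: -1; 0; 1]].
Proof.
move=> hX; have [Y [XY mY]] := herm_monomial hX.
have hY := borel_congr_herm hX XY.
(* A diagonal congruence multiplies entry [(i, j)] by [d i * conj (d j)]. For an off-diagonal pair
   the smaller index carries the inverse of the entry and the larger carries [1]; a diagonal entry
   is normalised by [conj_norm]. *)
have scale (i : 'I_n) : exists d : F,
    [/\ d != 0, forall j : 'I_n, (i < j)%N -> Y i j != 0 -> d * Y i j = 1,
        Y i i != 0 -> d * Y i i * conj d = 1 \/ d * Y i i * conj d = -1 &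
        forall j : 'I_n, (j < i)%N -> Y i j != 0 -> d = 1].
  have [/existsP[j Yij]|] := boolP [exists j, Y i j != 0]; last first.
    rewrite negb_exists => /forallP h; exists 1; rewrite oner_eq0.
    by split=> // [j _|] Yij; [have := h j | have := h i]; rewrite Yij.
  have ej k : Y i k != 0 -> k = j by move=> Yik; apply: mY Yik Yij.
  case: (ltngtP i j) => [ij|ji|/val_inj eij].
  - exists (Y i j)^-1; split=> [|k _ /ej->|/ej eij|k ki /ej ekj].
    + by rewrite invr_eq0.
    + exact: mulVf.
    + by rewrite eij ltnn in ij.
    + by move: (ltn_trans ki ij); rewrite ekj ltnn.
  - exists 1; rewrite oner_eq0; split=> // [k ik /ej ekj|/ej eij].
      by move: (ltn_trans ji ik); rewrite ekj ltnn.
    by rewrite eij ltnn in ji.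
  - subst j; have [c [c0 hc]] := conj_norm (esym (herm_entry i i hY)) Yij.
    by exists c; split=> // k ik /ej eki; rewrite eki ltnn in ik.
have [d hd] := fin_all_exists scale.
pose b : 'M[F]_n := diag_mx (\row_i d i).
have bE i j : b i j = d i *+ (i == j) by rewrite !mxE.
have tb : upper_tri b.
  by apply/upper_triP=> i j ji; rewrite bE -val_eqE /= gtn_eqF.
pose Z := b *m Y *m adj b.
have ZE i j : Z i j = d i * Y i j * conj (d j).
  rewrite /Z; have -> : adj b = diag_mx (\row_i conj (d i)).
    rewrite /adj_mx map_diag_mx tr_diag_mx; congr diag_mx.
    by apply/rowP=> k; rewrite !mxE.
  by rewrite mul_mx_diag mxE mul_diag_mx !mxE.
have d0 i : d i != 0 by case: (hd i).
have Z0 i j : (Z i j == 0) = (Y i j == 0).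
  by rewrite ZE !mulf_eq0 fmorph_eq0 !(negbTE (d0 _)) orbF.
have YZ : borel_congr Y Z.
  by exists b; split=> //; apply/(upper_tri_unitP tb)=> i; rewrite bE eqxx; apply: d0.
have hZ := borel_congr_herm hY YZ.
have Zlt (i j : 'I_n) : (i < j)%N -> Y i j != 0 -> Z i j = 1.
  move=> ij Yij; have [_ h1 _ _] := hd i; have [_ _ _ h2] := hd j.
  by rewrite ZE h1 // (h2 i) // ?rmorph1 ?mulr1 // herm_entry_eq0.
exists Z; split; first exact: borel_congr_trans XY YZ.
  by move=> i j k iT; rewrite !Z0; apply: mY.
move=> i j; rewrite !inE Z0; have [//|Yij] := eqVneq (Y i j) 0; first by rewrite orbT.
case: (ltngtP i j) => [ij|ji|/val_inj eij].
- by rewrite Zlt // eqxx !orbT.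
- by rewrite herm_entry // Zlt // ?rmorph1 ?eqxx ?orbT // herm_entry_eq0.
- subst j; have [_ _ h _] := hd i; rewrite ZE.
  by case: (h Yij) => ->; rewrite eqxx ?orbT.
Qed.

End HermitianCongruence.

(** * Surjectivity: every Lagrangian subspace has a normal form *)

Section Existence.
Context (F : numFieldType) (conj : {rmorphism F -> F}) (n : nat).
Hypothesis conjK : involutive conj.
Hypothesis conj_norm : forall x : F, conj x = x -> x != 0 ->
  exists c, c != 0 /\ (c * x * conj c = 1 \/ c * x * conj c = -1).
Local Notation adj := (adj_mx conj).
Local Notation P := (coord_proj F).

(* [T] collects the rows of [C] that depend on the preceding ones. *)
Lemma lower_row_reduction (C : 'M[F]_n) :
  exists (c h : 'M[F]_n) (T : {set 'I_n}),
    [/\ upper_tri c^T, c \in unitmx, c *m C = P (~: T) *m C &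
        P (~: T) *m C *m h = P (~: T)].
Proof.
pose pre (i : 'I_n) : 'M[F]_n := \matrix_(k, j) if (k < i)%N then C k j else 0.
pose T := [set i | (row i C <= pre i)%MS].
(* Row [i] of [L] holds coefficients expressing row [i] of [C] through the preceding rows.
   Truncation to [k < i] loses nothing, as the remaining rows of [pre i] are zero, and it makes
   [1 - L] lower unitriangular. *)
pose L : 'M[F]_n := \matrix_(i, k)
  if (i \in T) && (k < i)%N then (row i C *m pinvmx (pre i)) 0 k else 0.
have LC i j : (L *m C) i j = if i \in T then C i j else 0.
  rewrite mxE; case: (boolP (i \in T)) => iT; last first.
    by rewrite big1 // => k _; rewrite mxE (negbTE iT) mul0r.
  have : (row i C <= pre i)%MS by rewrite inE in iT.
  move=> /mulmxKpV/matrixP/(_ 0 j); rewrite [RHS]mxE => <-.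
  rewrite [RHS]mxE; apply: eq_bigr => k _; rewrite mxE [pre i k j]mxE iT /=.
  by case: ifP => // _; rewrite mul0r mulr0.
have tc : upper_tri (1%:M - L)^T.
  apply/upper_triP=> i j ji; rewrite !mxE -val_eqE /= ltn_eqF //.
  by rewrite ltnNge ltnW //= andbF subrr.
have [h eh] : exists h, P (~: T) *m C *m h = P (~: T).
  set D := P (~: T) *m C.
  suff /submxP[h eh] : (P (~: T) <= D^T)%MS.
    exists h^T; apply: trmx_inj.
    by rewrite trmx_mul trmxK tr_coord_proj -eh.
  rewrite submxE; set K := cokermx _.
  have KD : K^T *m D = 0.
    by apply: trmx_inj; rewrite trmx_mul trmxK trmx0 mulmx_coker.
  suff KP : K^T *m P (~: T) = 0.
    by rewrite -trmx_eq0 trmx_mul tr_coord_proj KP.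
  apply/eqP; apply: contraT => /matrix0Pn[r [i1 hi1]].
  pose u := K^T *m P (~: T).
  have uT i : i \in T -> u r i = 0.
    by move=> iT; rewrite coord_proj_mulE inE iT mulr0.
  have uC : u *m C = 0 by rewrite /u -mulmxA.
  have {hi1} : u r i1 != 0 by [].
  (* In a nontrivial relation [u] among the rows outside [T], the last row with nonzero coefficient
     depends on the preceding ones, hence belongs to [T]: a contradiction. The rows outside [T] are
     therefore independent and admit the right inverse [h]. *)
  clearbody u => hi1; case: (@arg_maxnP _ i1 [pred i | u r i != 0] val hi1) => i /= ui i_max.
  have iT : i \notin T.
    by apply: contraNN ui => /uT->.
  case/negP: iT; rewrite inE; apply/submxP.
  exists (\row_k if (k < i)%N then - (u r k / u r i) else 0).
  apply/rowP=> j; rewrite mxE [RHS]mxE.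
  have : (u *m C) r j = 0 by rewrite uC mxE.
  rewrite mxE (bigD1 i) //= => /eqP; rewrite addr_eq0 => /eqP e.
  apply: (mulfI ui); rewrite e mulr_sumr [RHS](bigD1 i) //= [in RHS]mxE ltnn mul0r mulr0 add0r.
  rewrite -sumrN; apply: eq_bigr => k ki; rewrite 2![in RHS]mxE.
  case: ifP => [_|/negbT]; first by rewrite [RHS]mulrA mulrN [u r i * _]mulrC divfK // mulNr.
  rewrite -leqNgt => ik; suff -> : u r k = 0 by rewrite !mul0r mulr0 oppr0.
  apply/eqP; apply: contraNT ki => /i_max ki.
  by apply/eqP/val_inj/anti_leq; rewrite /= ki ik.
exists (1%:M - L), h, T; split=> //.
  rewrite -unitmx_tr; apply/(upper_tri_unitP tc)=> i.
  by rewrite !mxE eqxx ltnn andbF subr0 oner_eq0.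
apply/matrixP=> i j; rewrite mulmxBl mul1mx mul_coord_projE inE [LHS]mxE.
rewrite [X in _ + X]mxE LC; case: (i \in T); rewrite /= ?subrr ?mul0r //.
by rewrite subr0 mul1r.
Qed.

Lemma adj_coord_proj (T : {set 'I_n}) : adj (P T) = P T.
Proof. by rewrite /adj_mx map_coord_proj tr_coord_proj. Qed.

Lemma H_elt_lagrangian (b : 'M[F]_n) (M : 'M[F]_(n + n, n)) : b \in unitmx ->
  lagrangian conj (Sigma_mx F n) M ->
  lagrangian conj (Sigma_mx F n) (H_elt conj b *m M).
Proof.
move=> ub; rewrite -[M]vsubmxK H_elt_col => /lagrangian_col[rk sym].
apply/lagrangian_col; split.
  have [_ uH] := mulmx1_unit (H_eltV conj ub).
  by rewrite -H_elt_col -mxrank_tr trmx_mul mxrankMfree ?mxrank_tr //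
    row_free_unit unitmx_tr.
rewrite !adj_mxM adj_mx_inv (adj_mxK conjK) -!mulmxA.
by rewrite mulKmx // mulKVmx ?adj_mx_unit.
Qed.

(* After the row reduction of the bottom block the subspace is the graph of a
   Hermitian form on the coordinates outside [T]. *)
Lemma lagrangian_graph (M : 'M[F]_(n + n, n)) :
  lagrangian conj (Sigma_mx F n) M ->
  exists T (X : 'M[F]_n), [/\ adj X = X, P (~: T) *m X = X,
    X *m P (~: T) = X & BH_equiv conj M (normal_form T X)].
Proof.
move=> LM; have [c [h [T [tc uc cC ch]]]] := lower_row_reduction (dsubmx M).
have uac : adj c \in unitmx by rewrite adj_mx_unit.
(* Chosen so that the lower block of [H_elt conj b] is [c]; the inverse adjoint of a lower
   triangular matrix is upper triangular. *)
pose b := invmx (adj c); have ub : b \in unitmx by rewrite unitmx_inv.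
have tb : upper_tri b.
  apply: upper_tri_invmx => //; apply/upper_triP=> i j ji; rewrite !mxE.
  by have /upper_triP/(_ i j ji) := tc; rewrite mxE => ->; rewrite rmorph0.
have := H_elt_lagrangian ub LM.
have eM : H_elt conj b *m M = col_mx (b *m usubmx M) (c *m dsubmx M).
  by rewrite -{1}[M]vsubmxK H_elt_col /b adj_mx_inv (adj_mxK conjK) invmxK.
rewrite eM; set A := b *m usubmx M in eM *; set C := c *m dsubmx M in eM * => LM1.
have PC : P (~: T) *m C = C by rewrite /C cC mulmxA coord_proj_id.
have Ch : C *m h = P (~: T) by rewrite /C cC.
clearbody A C.
have adjCP : adj C *m P (~: T) = adj C.
  by rewrite -{2}PC adj_mxM adj_coord_proj.
have [_ CA] := proj1 (lagrangian_col conj A C) LM1.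
pose X := P (~: T) *m (A *m h) *m P (~: T).
have PX : P (~: T) *m X = X by rewrite /X !mulmxA coord_proj_id.
have XP : X *m P (~: T) = X by rewrite /X -!mulmxA coord_proj_id.
(* Since [P (~: T) = adj h *m adj C], the Lagrangian identity [adj C *m A = adj A *m C] exchanges
   the two factors. This is what makes [X] Hermitian. *)
have e1 : P (~: T) *m (A *m h) = adj (A *m h) *m P (~: T).
  have PhC : P (~: T) = adj h *m adj C by rewrite -adj_mxM Ch adj_coord_proj.
  by rewrite {1}PhC -Ch adj_mxM -!mulmxA (mulmxA (adj C)) CA !mulmxA.
have hX : adj X = X.
  have -> : X = P (~: T) *m (A *m h) by rewrite /X e1 -mulmxA coord_proj_id.
  by rewrite adj_mxM adj_coord_proj -e1.
exists T, X; split=> //; exists b; split=> //; rewrite eM.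
apply/same_colspace_sym/(lagrangian_same_colspace LM1).
  by rewrite mxrank_normal_form // -PX mulmxA coord_projC mul0mx.
rewrite /normal_form Sigma_col mulmxDr.
have -> : adj C *m P T = 0 by rewrite -adjCP -mulmxA coord_projCl mulmx0.
have -> : adj C *m X = adj A *m P (~: T).
  rewrite /X !mulmxA adjCP CA -(mulmxA _ C) Ch -mulmxA.
  by rewrite coord_proj_id.
by rewrite add0r subrr.
Qed.

Lemma lagrangian_normal_form (M : 'M[F]_(n + n, n)) :
  lagrangian conj (Sigma_mx F n) M ->
  exists T X, normal_data T X /\ BH_equiv conj (intmx F (normal_form T X)) M.
Proof.
move=> /lagrangian_graph[T [Y [hY PY YP MY]]].
have [Z [[b [tb ub eZ]] mZ vZ]] := herm_normal_form conjK conj_norm hY.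
have hZ : adj Z = Z by apply: (borel_congr_herm conjK hY); exists b.
(* The reducing matrix [b] is kept only outside [T], where [Y] lives, and replaced by the identity
   on [T], so that [P T] is preserved. *)
pose b' := P T + P (~: T) *m b *m P (~: T).
have bE i j : b' i j = if (i \in T) || (j \in T) then (i == j)%:R else b i j.
  rewrite mxE coord_projE coord_proj_mulE mul_coord_projE !inE.
  case: (boolP (i \in T)) => iT /=; first by rewrite andbT !mul0r addr0.
  rewrite andbF add0r mul1r; case: (boolP (j \in T)) => jT /=; last by rewrite mulr1.
  by rewrite mulr0; case: eqVneq => // eij; rewrite eij jT in iT.
have tb' : upper_tri b'.
  apply/upper_triP=> i j ji; rewrite bE (upper_triP _ tb) //.
  by rewrite -val_eqE /= gtn_eqF // if_same.
have ub' : b' \in unitmx.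
  apply/(upper_tri_unitP tb')=> i; rewrite bE eqxx orbb; case: ifP => _.
    exact: oner_neq0.
  exact: upper_tri_unitP.
have b'PT : b' *m P T = P T.
  by rewrite mulmxDl coord_proj_id -!mulmxA coord_projCl !mulmx0 addr0.
have PTb' : P T *m adj b' = P T.
  by rewrite -{1}adj_coord_proj -adj_mxM b'PT adj_coord_proj.
have b'P : b' *m P (~: T) = P (~: T) *m b *m P (~: T).
  by rewrite mulmxDl coord_projC add0r -!mulmxA coord_proj_id.
have Pb' : P (~: T) *m b' = P (~: T) *m b *m P (~: T).
  by rewrite mulmxDr coord_projCl add0r !mulmxA coord_proj_id.
have comm : P (~: T) *m adj b' = adj b' *m P (~: T).
  by rewrite -{1}adj_coord_proj -adj_mxM b'P -Pb' adj_mxM adj_coord_proj.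
pose W := P (~: T) *m Z *m P (~: T).
have eW : b' *m Y *m adj b' = W.
  rewrite -{1}PY -{1}YP !mulmxA b'P -!mulmxA comm.
  have -> : adj b' *m P (~: T) = P (~: T) *m (adj b *m P (~: T)).
    by rewrite -comm -{1}adj_coord_proj -adj_mxM b'P !adj_mxM adj_coord_proj mulmxA.
  rewrite !mulmxA -(mulmxA _ Y) YP -(mulmxA _ _ Y) PY.
  by rewrite /W eZ !mulmxA -(mulmxA _ _ Y) ?YP.
pose X : 'M[int]_n := \matrix_(i, j)
  if (i \in T) || (j \in T) then 0
  else if Z i j == 1 then 1 else if Z i j == -1 then -1 else 0.
have eq01 : (0 == 1 :> F) = false by rewrite eq_sym oner_eq0.
have eq0N1 : (0 == -1 :> F) = false by rewrite eq_sym oppr_eq0 oner_eq0.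
have XE : intmx F X = W.
  apply/matrixP=> i j; rewrite 2!mxE coord_proj_mulE mul_coord_projE !inE.
  case: (i \in T); first by rewrite !mul0r.
  case: (j \in T); first by rewrite mulr0.
  rewrite /= mul1r mulr1; have := vZ i j; rewrite !inE.
  case/or3P=> /eqP->; rewrite ?eqxx //.
    by rewrite eq_sym -addr_eq0 -mulr2n pnatr_eq0.
  by rewrite eq01 eq0N1.
have X0 i j : X i j != 0 -> [/\ i \notin T, j \notin T & Z i j != 0].
  rewrite mxE; case: ifP => [_|/negbT]; first by rewrite eqxx.
  rewrite negb_or => /andP[-> ->].
  have [->|//] := eqVneq (Z i j) 0.
  by rewrite eq01 eq0N1 eqxx.
have hX : normal_data T X.
  split.
  - have /matrixP sX : intmx F X^T = intmx F X.
      by rewrite -(adj_intmx conj) XE /W !adj_mxM adj_coord_proj hZ mulmxA.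
    apply/matrixP=> i j; have := sX i j.
    by rewrite [LHS]mxE [RHS]mxE => /intr_inj.
  - by move=> i j; rewrite mxE; do 3?case: ifP.
  - by move=> i j k /X0[_ _ Zj] /X0[_ _ Zk]; apply: mZ Zj Zk; rewrite inE.
  - by move=> i j /X0[].
exists T, X; split=> //; apply/BH_equiv_sym/(BH_equiv_trans MY).
exists b'; split=> //; rewrite intmx_normal_form XE H_elt_col.
have uab : adj b' \in unitmx by rewrite adj_mx_unit.
apply: same_colspace_sym; set N := col_mx _ _.
(* Right multiplication by [adj b'] cancels the inverse adjoint in the bottom block and completes
   the congruence [b' *m Y *m adj b' = W] in the top block. *)
have -> : normal_form T W = N *m adj b'; last exact: same_colspace_mulr.
rewrite mul_col_mx -(mulmxA _ (P (~: T))) comm mulKmx // mulmxDr mulmxDl b'PT PTb'.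
by rewrite eW.
Qed.

End Existence.

(** Isolates what the two cases share. The scaling property of [conj] normalises Hermitian forms in
    the surjectivity part, and the exclusion of [-1] as a norm separates diagonal signs in the
    injectivity part. *)
Lemma induces_bijection_Sigma (F : numFieldType) (conj : {rmorphism F -> F})
    (n : nat) (k : F) :
  involutive conj ->
  (forall x : F, conj x = x -> x != 0 ->
    exists c, c != 0 /\ (c * x * conj c = 1 \/ c * x * conj c = -1)) ->
  (forall c : F, c * conj c != -1) -> k != 0 ->
  induces_bijection conj (k *: Sigma_mx F n).
Proof.
move=> conjK conj_norm conj_norm_neqN1 k0; split.
- move=> w [t1 [t2 [-> _ _ sym rk]]]; apply/(lagrangianZ _ _ k0).
  exact: intmx_lagrangian.
- by move=> w w' _ _; apply: Omega_equiv_BH.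
- move=> w w' /Omega0_normal_form[T [X [hX wX]]].
  move=> /Omega0_normal_form[T' [X' [hX' wX']]] ww'.
  apply: (Omega_equiv_trans wX).
  apply: (Omega_equiv_trans _ (Omega_equiv_sym wX')).
  apply: (BH_normal_form_inj conj_norm_neqN1 hX hX').
  apply: BH_equiv_trans (BH_equiv_sym (Omega_equiv_BH conj wX)) _.
  exact: BH_equiv_trans ww' (Omega_equiv_BH conj wX').
- move=> M /(lagrangianZ _ _ k0) /(lagrangian_normal_form conjK conj_norm).
  move=> [T [X [hX XM]]]; exists (normal_form T X); split=> //.
  exact: normal_form_Omega0.
Qed.

Lemma sqrt_scaling (R : rcfType) (x : R) : x != 0 ->
  exists c, c != 0 /\ (c * x * c = 1 \/ c * x * c = -1).
Proof.
move=> x0; exists (Num.sqrt `|x|)^-1.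
have s2 : (Num.sqrt `|x|)^-1 * x * (Num.sqrt `|x|)^-1 = x / `|x|.
  by rewrite mulrAC mulrC -invfM -expr2 sqr_sqrtr.
split; first by rewrite invr_eq0 gt_eqF // sqrtr_gt0 normr_gt0.
rewrite s2; have [x_gt0|x_le0] := ltrP 0 x; [left | right].
  by rewrite gtr0_norm // divff.
by rewrite ler0_norm // invrN mulrN divff.
Qed.

Theorem theorem5p5 (R : realType) (n : nat) (hn : (1 <= n)%N) :
  caseA R n /\ caseB R n.
Proof.
split.
- apply: (@induces_bijection_Sigma R[i] (@conjc R)).
  + exact: conjcK.
  (* A number fixed by conjugation has imaginary part [b = - b], hence zero, so the real scaling
     factor serves. *)
  + case=> a b /eqP; rewrite eq_complex /= => /andP[_ b0].
    move: b0; rewrite eqNr => /eqP->.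
    rewrite eq_complex /= eqxx andbT => /sqrt_scaling[c [c0 hc]].
    exists c%:C%C; split; first by rewrite eq_complex /= eqxx andbT.
    have -> : (c%:C * (a +i* 0) * conjc c%:C)%C = (c * a * c)%:C%C.
      by apply/eqP; rewrite eq_complex /= !(mulr0, mul0r, subr0, addr0, oppr0) !eqxx.
    by case: hc => ->; [left | right; apply/eqP; rewrite eq_complex /= oppr0 !eqxx].
  + move=> c; apply/negP=> /eqP h; have := mulcJ_ge0 c.
    by rewrite h oppr_ge0 ler10.
  + by rewrite eq_complex /= oner_eq0 andbF.
- rewrite /caseB -[Sigma_mx R n]scale1r.
  apply: (@induces_bijection_Sigma R (idfun : {rmorphism R -> R})) => //.
  + by move=> x _; apply: sqrt_scaling.
  + move=> c; apply/negP=> /eqP h; have := sqr_ge0 c.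
    by rewrite expr2 h oppr_ge0 ler10.
  + exact: oner_neq0.
Qed.
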